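(* Let $G$ be a graph with at least one edge, let $\lambda_1$ and $\lambda_n$ be the largest and smallest eigenvalues of its adjacency matrix, and suppose that $G$ is Hoffman colourable, i.e. $\chi(G)=1-\frac{\lambda_1}{\lambda_n}$. Then for every integer $d\ge0$, $$\chi(G)=\chi^d(G\boxtimes K_{d+1}).$$
   Context: Graphs are finite and simple. $\chi$ is the usual chromatic number. A colouring of a graph is $d$-improper if each vertex $v$ has at most $d$ neighbours of the same colour as $v$; $\chi^d$ denotes the least number of colours in a $d$-improper colouring. The strong product $G\boxtimes H$ has vertex set $V(G)\times V(H)$, where $(u,u')$ and $(v,v')$ are adjacent if (i) $u=v$ and $u'\sim v'$ in $H$, or (ii) $u'=v'$ and $u\sim v$ in $G$, or (iii) $u\sim v$ in $G$ and $u'\sim v'$ in $H$. $K_{d+1}$ is the complete graph on $d+1$ vertices. *)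

(* Defs.v *)
From HB Require Import structures.
From mathcomp Require Import all_boot all_order all_algebra.
From mathcomp Require Import reals.

Set Implicit Arguments.
Unset Strict Implicit.
Unset Printing Implicit Defensive.

Import Order.TTheory GRing.Theory Num.Theory.

Record sgraph := SGraph {
  vertex :> finType;
  adj : rel vertex;
  adj_sym : symmetric adj;
  adj_irrefl : irreflexive adj
}.

Definition complete_adj (n : nat) : rel 'I_n := fun x y => x != y.

Lemma complete_sym (n : nat) : symmetric (@complete_adj n).
Proof. by move=> x y; rewrite /complete_adj eq_sym. Qed.

Lemma complete_irrefl (n : nat) : irreflexive (@complete_adj n).
Proof. by move=> x; rewrite /complete_adj eqxx. Qed.

Definition complete_graph (n : nat) : sgraph :=
  SGraph (@complete_sym n) (@complete_irrefl n).

Definition strong_adj (G H : sgraph) : rel (G * H)%type := fun p q =>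
  [|| (p.1 == q.1) && adj p.2 q.2,
      (p.2 == q.2) && adj p.1 q.1
    | adj p.1 q.1 && adj p.2 q.2].

Lemma strong_sym (G H : sgraph) : symmetric (@strong_adj G H).
Proof.
move=> p q; rewrite /strong_adj (eq_sym p.1) (eq_sym p.2).
by rewrite (adj_sym p.1) (adj_sym p.2).
Qed.

Lemma strong_irrefl (G H : sgraph) : irreflexive (@strong_adj G H).
Proof. by move=> p; rewrite /strong_adj !adj_irrefl !andbF. Qed.

Definition strong_product (G H : sgraph) : sgraph :=
  SGraph (@strong_sym G H) (@strong_irrefl G H).

Definition proper_colouring (G : sgraph) (k : nat) (c : {ffun G -> 'I_k}) : bool :=
  [forall u, forall v, adj u v ==> (c u != c v)].

Definition improper_colouring (d : nat) (G : sgraph) (k : nat)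
    (c : {ffun G -> 'I_k}) : bool :=
  [forall v, #|[set w | adj v w && (c w == c v)]| <= d].

Definition colourable (G : sgraph) (k : nat) : bool :=
  [exists c : {ffun G -> 'I_k}, proper_colouring c].

Definition improper_colourable (d : nat) (G : sgraph) (k : nat) : bool :=
  [exists c : {ffun G -> 'I_k}, improper_colouring d c].

Lemma ex_colourable (G : sgraph) : exists k, colourable G k.
Proof.
exists #|G|; apply/existsP; exists [ffun v => enum_rank v].
apply/forallP => u; apply/forallP => v; apply/implyP => uv.
rewrite !ffunE (inj_eq enum_rank_inj); apply/eqP => euv.
by rewrite euv adj_irrefl in uv.
Qed.

Lemma ex_improper_colourable (d : nat) (G : sgraph) :
  exists k, improper_colourable d G k.
Proof.
have [k /existsP[c /forallP pc]] := ex_colourable G.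
exists k; apply/existsP; exists c; apply/forallP => v.
rewrite (_ : [set w | _] = set0) ?cards0 //.
apply/setP => w; rewrite !inE; apply/negbTE/negP => /andP[vw /eqP cwv].
by move/forallP: (pc v) => /(_ w); rewrite vw cwv eqxx.
Qed.

Definition chromatic_number (G : sgraph) : nat := ex_minn (ex_colourable G).

Definition improper_chromatic_number (d : nat) (G : sgraph) : nat :=
  ex_minn (ex_improper_colourable d G).

Local Open Scope ring_scope.

(* Rows and columns are indexed through the enumeration of the vertices; the
   spectrum does not depend on the enumeration. *)
Definition adjacency_matrix (R : realType) (G : sgraph) : 'M[R]_#|G| :=
  \matrix_(i, j) (adj (enum_val i) (enum_val j))%:R.

Definition largest_eigenvalue (R : realType) (n : nat) (A : 'M[R]_n) (a : R) : Prop :=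
  eigenvalue A a /\ forall b : R, eigenvalue A b -> b <= a.

Definition smallest_eigenvalue (R : realType) (n : nat) (A : 'M[R]_n) (a : R) : Prop :=
  eigenvalue A a /\ forall b : R, eigenvalue A b -> a <= b.

(* Main.v *)
Require Import Defs.
From HB Require Import structures.
From mathcomp Require Import all_boot all_order all_algebra.
From mathcomp Require Import reals.
From mathcomp Require Import spectral complex ring lra.

Import Order.TTheory GRing.Theory Num.Theory.
Local Open Scope ring_scope.

(** A proper colouring of G, lifted to the strong product by forgetting the
    second coordinate, gives each vertex only the d other vertices of its own
    fibre as neighbours of the same colour; so the improper chromatic number is
    at most the chromatic number ([improper_colourable_strong]).

    Conversely a d-improper k-colouring of the strong product splits each of
    the d+1 vertices over u among the colours: let w_a(u) be the number of
    those of colour a. Then the w_a sum to d+1 at every vertex, and improperness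
    says that a colour present over u has total weight at most d+1 on the closed
    neighbourhood of u. For such a weighting, Hoffman's bound survives
    ([weighted_hoffman]). Indeed let x be an eigenvector for the largest
    eigenvalue l1, let ln be the smallest eigenvalue, and let M = A - ln I,
    which is positive semidefinite ([rayleigh_lower]). The vectors z_a = w_a x
    (entrywise) sum to (d+1) x, so by convexity of the form of M
    ([psd_form_sum_le])

      (d+1)^2 (l1 - ln) |x|^2 <= k * sum_a z_a M z_a^T,

    while the weight condition and ln <= -1 bound the sum on the right by
    (d+1)^2 (-ln) |x|^2. Hence k >= 1 - l1 / ln, which for a Hoffman colourable
    graph is the chromatic number. *)

(** * Quadratic forms of symmetric matrices *)

Lemma form_sum (R : comNzRingType) (n : nat) (M : 'M[R]_n) (x y : 'rV[R]_n) :
  (x *m M *m y^T) 0 0 = \sum_i \sum_j M i j * x 0 i * y 0 j.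
Proof.
rewrite -mulmxA mxE; apply: eq_bigr => i _.
rewrite mxE big_distrr /=; apply: eq_bigr => j _.
by rewrite mxE; ring.
Qed.

Lemma sqnorm_sum (R : comNzRingType) (n : nat) (x : 'rV[R]_n) :
  (x *m x^T) 0 0 = \sum_i x 0 i ^+ 2.
Proof. by rewrite mxE; apply: eq_bigr => i _; rewrite mxE expr2. Qed.

(** Over the complex numbers A = P^-1 D P with P unitary and D diagonal; D is
    real because A is Hermitian, and its entries are eigenvalues of the real
    matrix A. In the coordinates y = x P^-1 both sides are diagonal forms, so
    the inequality is checked entry by entry. *)
Lemma rayleigh_lower (R : rcfType) (n : nat) (A : 'M[R]_n) (a : R) :
  A^T = A -> (forall b, eigenvalue A b -> a <= b) ->
  forall x : 'rV[R]_n, a * (x *m x^T) 0 0 <= (x *m A *m x^T) 0 0.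
Proof.
move=> symA minA x.
pose toC : {rmorphism R -> R[i]} := real_complex R.
have toC_conj m p (B : 'M[R]_(m, p)) :
    map_mx Num.conj (map_mx toC B) = map_mx toC B.
  by apply/matrixP => i j; rewrite !mxE; apply: (@conjc_real R).
pose AC := map_mx toC A.
have hermA : AC \is hermsymmx.
  apply/is_hermitianmxP; rewrite expr0 scale1r.
  by rewrite -map_trmx toC_conj /AC map_trmx symA.
have /orthomx_spectralP := hermitian_normalmx hermA.
set P := spectralmx AC; set D := spectral_diag AC => defA.
have unitP : P \in unitmx := spectral_unit AC.
have invP : invmx P = map_mx Num.conj P^T.
  by rewrite invmx_unitary ?spectral_unitarymx.
have D_ge i : toC a <= D 0 i.
  have [r Dr] : exists r, D 0 i = toC r.
    have /mxOverP/(_ 0 i) := hermitian_spectral_diag_real hermA.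
    rewrite -/D; case: (D 0 i) => r s /orP[] Dr; exists r.
      by rewrite (_ : s = 0) //; apply: (ger0_Im Dr).
    by move: Dr; rewrite lecE /= => /andP[/eqP <-].
  rewrite Dr lecR; apply: minA.
  rewrite -(eigenvalue_map toC) -/AC -Dr; apply/eigenvalueP.
  exists (row i P).
    have PA : P *m AC = diag_mx D *m P by rewrite {1}defA !mulmxA mulmxV ?mul1mx.
    by rewrite -row_mul PA mul_diag_mx; apply/rowP => j; rewrite !mxE.
  apply/eqP => Pi0; have := unitP; rewrite -row_free_unit => /row_freeP[Q PQ].
  have /rowP/(_ i) : row i P *m Q = row i 1%:M by rewrite -row_mul PQ.
  by rewrite Pi0 mul0mx !mxE eqxx => /eqP; rewrite eq_sym oner_eq0.
pose y := map_mx toC x *m invmx P.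
have ytr : map_mx Num.conj y^T = P *m (map_mx toC x)^T.
  rewrite /y trmx_mul map_mxM invP -!map_trmx toC_conj !trmxK.
  by congr (_ *m _); apply/matrixP => i j; rewrite !mxE; apply: conjCK.
have toC_form : toC ((x *m A *m x^T) 0 0) =
    \sum_i D 0 i * (y 0 i * Num.conj (y 0 i)).
  transitivity ((y *m diag_mx D *m map_mx Num.conj y^T) 0 0).
    rewrite ytr -!mulmxA [diag_mx D *m _]mulmxA (mulmxA (invmx P)).
    rewrite [invmx P *m _]mulmxA -defA mulmxA map_trmx -!map_mxM.
    by rewrite [RHS]mxE mulmxA.
  rewrite mul_mx_diag mxE; apply: eq_bigr => i _.
  by rewrite !mxE; ring.
have toC_norm : toC ((x *m x^T) 0 0) = \sum_i y 0 i * Num.conj (y 0 i).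
  transitivity ((y *m map_mx Num.conj y^T) 0 0).
    by rewrite ytr -!mulmxA mulKmx // map_trmx -map_mxM [RHS]mxE.
  by rewrite mxE; apply: eq_bigr => i _; rewrite !mxE.
rewrite -lecR -!/(toC _) rmorphM /= toC_form toC_norm mulr_sumr.
apply: ler_sum => i _; apply: ler_wpM2r; last exact: D_ge.
exact: mul_conjC_ge0.
Qed.

(** This is k^2 times the Jensen inequality for the convex form of M at the mean
    s / k of the z_a, where s is their sum; it follows by adding up the values,
    all nonnegative, of the form at the deviations k z_a - s. *)
Lemma psd_form_sum_le (R : realFieldType) (n k : nat) (M : 'M[R]_n)
    (z : 'I_k -> 'rV[R]_n) :
  (forall x : 'rV[R]_n, 0 <= (x *m M *m x^T) 0 0) ->
  ((\sum_a z a) *m M *m (\sum_a z a)^T) 0 0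
    <= k%:R * \sum_a (z a *m M *m (z a)^T) 0 0.
Proof.
move=> psdM; set s := \sum_a z a.
case: (posnP k) => [k0|k_gt0].
  have noI (i : 'I_k) : False by case: i => i; rewrite k0.
  by rewrite /s !big1 ?mul0mx ?mxE ?mulr0 // => i; case: (noI i).
have kR : 0 < k%:R :> R by rewrite ltr0n.
pose B (x y : 'rV[R]_n) := (x *m M *m y^T) 0 0.
have Bsuml y : B s y = \sum_a B (z a) y.
  by rewrite /B /s !mulmx_suml summxE.
have Bsumr x : B x s = \sum_a B x (z a).
  by rewrite /B /s raddf_sum mulmx_sumr summxE.
have expand a : B (k%:R *: z a - s) (k%:R *: z a - s) =
    k%:R ^+ 2 * B (z a) (z a) - k%:R * (B (z a) s + B s (z a)) + B s s.
  rewrite /B linearB linearZ /= !(mulmxBl, mulmxBr) -!scalemxAl -!scalemxAr.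
  by rewrite !mxE; ring.
have : 0 <= \sum_a B (k%:R *: z a - s) (k%:R *: z a - s).
  by apply: sumr_ge0 => a _; apply: psdM.
under eq_bigr => a _ do rewrite expand.
rewrite !big_split /= sumr_const card_ord sumrN -!mulr_sumr big_split /=.
rewrite -Bsuml -Bsumr -/(B s s) -[B s s *+ k]mulr_natl => H.
rewrite -subr_ge0 -(pmulr_rge0 _ kR).
apply: le_trans H _; rewrite le_eqVlt; apply/orP; left; apply/eqP; rewrite /B.
ring.
Qed.

(** * Hoffman's bound for weighted colourings *)

(** For the adjacency matrix of a graph, proper colourings are the case where
    m = 1 and the w_a are the indicator functions of the colour classes; a
    weight m shared at each vertex between the colours,
    subject to the closed neighbourhood condition, obeys the same bound
    k >= 1 - l1 / ln, stated here without division. *)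
Lemma weighted_hoffman (R : realFieldType) (n k : nat) (A : 'M[R]_n)
    (l1 ln m : R) (w : 'I_k -> 'I_n -> R) :
  A^T = A -> (forall i j, 0 <= A i j) -> eigenvalue A l1 ->
  (forall x : 'rV[R]_n, ln * (x *m x^T) 0 0 <= (x *m A *m x^T) 0 0) ->
  ln <= -1 -> 0 < m -> (forall a i, 0 <= w a i <= m) ->
  (forall i, \sum_a w a i = m) ->
  (forall a i, w a i * (w a i + \sum_j A i j * w a j) <= m * w a i) ->
  l1 - ln <= k%:R * - ln.
Proof.
move=> symA A_ge0 /eigenvalueP[x xA x_neq0] ray ln_le m_gt0 w_bd w_sum w_deg.
pose M := A - ln%:M.
have formM (y : 'rV[R]_n) :
    (y *m M *m y^T) 0 0 = (y *m A *m y^T) 0 0 - ln * (y *m y^T) 0 0.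
  by rewrite mulmxBr mulmxBl mul_mx_scalar -scalemxAl !mxE.
have psdM (y : 'rV[R]_n) : 0 <= (y *m M *m y^T) 0 0.
  by rewrite formM subr_ge0.
pose z a : 'rV[R]_n := \row_i (w a i * x 0 i).
have sum_z : \sum_a z a = m *: x.
  apply/rowP => i; rewrite summxE mxE -(w_sum i) mulr_suml.
  by apply: eq_bigr => a _; rewrite mxE.
have x_gt0 : 0 < \sum_i x 0 i ^+ 2.
  rewrite lt_def sumr_ge0 => [|i _]; last exact: sqr_ge0.
  rewrite andbT; apply: contra x_neq0 => /eqP x0; apply/eqP/rowP => i.
  rewrite mxE; apply/eqP; rewrite -sqrf_eq0; apply/eqP.
  by apply: (psumr_eq0P _ x0) => // j _; apply: sqr_ge0.
(* Nonnegativity of A and w allows x_i x_j <= (x_i^2 + x_j^2) / 2 termwise; by symmetry of A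
   the two halves contribute equally. *)
have class_form a : (z a *m A *m (z a)^T) 0 0 <=
    \sum_i x 0 i ^+ 2 * (w a i * \sum_j A i j * w a j).
  rewrite form_sum.
  pose F i j := A i j * w a i * w a j * x 0 i ^+ 2.
  have -> : \sum_i x 0 i ^+ 2 * (w a i * \sum_j A i j * w a j) =
            \sum_i \sum_j F i j.
    apply: eq_bigr => i _; rewrite !big_distrr /=.
    by apply: eq_bigr => j _; rewrite /F; ring.
  have Fsym : \sum_i \sum_j F i j = \sum_i \sum_j F j i.
    by rewrite exchange_big.
  have -> : \sum_i \sum_j F i j = \sum_i \sum_j (F i j + F j i) / 2.
    under [RHS]eq_bigr => i _ do rewrite -mulr_suml big_split /=.
    by rewrite -mulr_suml big_split /= -Fsym; field.
  apply: ler_sum => i _; apply: ler_sum => j _.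
  have -> : A i j * z a 0 i * z a 0 j = A i j * w a i * w a j * (x 0 i * x 0 j).
    by rewrite !mxE; ring.
  have Aji : A j i = A i j by rewrite -[in LHS]symA mxE.
  have -> : (F i j + F j i) / 2 =
      A i j * w a i * w a j * ((x 0 i ^+ 2 + x 0 j ^+ 2) / 2).
    by rewrite /F Aji; field.
  apply: ler_wpM2l; last by have := sqr_ge0 (x 0 i - x 0 j); nra.
  have /andP[wi _] := w_bd a i; have /andP[wj _] := w_bd a j.
  by rewrite !mulr_ge0.
have class_bound a : (z a *m M *m (z a)^T) 0 0 <=
    \sum_i m * - ln * (x 0 i ^+ 2 * w a i).
  rewrite formM sqnorm_sum.
  apply: le_trans (lerB (class_form a) (lexx _)) _.
  rewrite mulr_sumr -sumrB; apply: ler_sum => i _; rewrite mxE.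
  rewrite (_ : _ - _ = x 0 i ^+ 2 *
     (w a i * (w a i + \sum_j A i j * w a j) + (- ln - 1) * (w a i * w a i)));
    last by ring.
  rewrite (_ : m * - ln * _ = x 0 i ^+ 2 *
     (m * w a i + (- ln - 1) * (m * w a i))); last by ring.
  apply: ler_wpM2l; first exact: sqr_ge0.
  apply: lerD; first exact: w_deg.
  (* - ln - 1 >= 0, so replacing one factor w a i by m only increases. *)
  have /andP[w0 wm] := w_bd a i.
  by rewrite ler_wpM2l ?ler_wpM2r //; lra.
have total : \sum_a (z a *m M *m (z a)^T) 0 0 <=
    m ^+ 2 * - ln * \sum_i x 0 i ^+ 2.
  apply: le_trans (ler_sum _ (fun a _ => class_bound a)) _.
  rewrite exchange_big /= mulr_sumr; apply: ler_sum => i _.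
  by rewrite -!mulr_sumr w_sum le_eqVlt; apply/orP; left; apply/eqP; ring.
have := psd_form_sum_le _ _ _ _ z psdM; rewrite sum_z.
have -> : (m *: x *m M *m (m *: x)^T) 0 0 =
    m ^+ 2 * (\sum_i x 0 i ^+ 2) * (l1 - ln).
  rewrite formM linearZ /= -!scalemxAl -!scalemxAr xA -scalemxAl.
  by rewrite -sqnorm_sum !mxE; ring.
move=> H; have {}H := le_trans H (ler_wpM2l (ler0n R k) total).
have m2 : 0 < m ^+ 2 by rewrite exprn_gt0.
rewrite -(ler_pM2l (mulr_gt0 m2 x_gt0)); apply: le_trans H _.
by rewrite le_eqVlt; apply/orP; left; apply/eqP; ring.
Qed.

(** * Colourings of the strong product with a complete graph *)

Lemma adjacency_tr (R : realType) (G : sgraph) :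
  (adjacency_matrix R G)^T = adjacency_matrix R G.
Proof. by apply/matrixP => i j; rewrite !mxE adj_sym. Qed.

(** The Rayleigh quotient of the difference of the indicators of two adjacent
    vertices is -2 / 2. *)
Lemma smallest_eigenvalue_le_m1 (R : realType) (G : sgraph) (u v : G) (a : R) :
  adj u v -> smallest_eigenvalue (adjacency_matrix R G) a -> a <= -1.
Proof.
move=> uv [_ a_min].
set A := adjacency_matrix R G in a_min *.
set i := enum_rank u; set j := enum_rank v.
have ij : i != j.
  by apply: contraTneq uv => /enum_rank_inj ->; rewrite adj_irrefl.
have := rayleigh_lower _ _ _ _ (adjacency_tr R G) a_min
  (delta_mx 0 i - delta_mx 0 j).
have form (B : 'M[R]_#|G|) :
    ((delta_mx 0 i - delta_mx 0 j) *m B *m (delta_mx 0 i - delta_mx 0 j)^T)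
      (0 : 'I_1) (0 : 'I_1) = B i i - B i j - B j i + B j j.
  rewrite linearB /= !trmx_delta mulmxBr !mulmxBl -!rowE -!colE !mxE.
  by ring.
(* The squared norm is the form of the identity matrix. *)
rewrite form -[X in X *m _^T]mulmx1 form !mxE !enum_rankK uv adj_sym uv.
rewrite !adj_irrefl !eqxx (negPf ij) eq_sym (negPf ij) /= => H; lra.
Qed.

(** A colour present over x at (x, i) occurs in the closed neighbourhood of
    (x, i), which is the union of the fibres over x and its neighbours, at most
    d+1 times; this is the hypothesis of [weighted_hoffman] on the weights N. *)
Lemma improper_hoffman_bound (R : realType) (G : sgraph) (l1 ln : R) (k d : nat)
    (u v : G) :
  adj u v -> largest_eigenvalue (adjacency_matrix R G) l1 ->
  smallest_eigenvalue (adjacency_matrix R G) ln ->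
  improper_colourable d (strong_product G (complete_graph d.+1)) k ->
  1 - l1 / ln <= k%:R.
Proof.
move=> uv [l1_eig _] lnP /existsP[c /forallP c_imp].
have ln_le := smallest_eigenvalue_le_m1 _ _ _ _ _ uv lnP.
case: lnP => _ ln_min.
pose N (a : 'I_k) (x : G) : nat :=
  #|[set i : 'I_d.+1 | c (x, i) == a]|.
have N_sum x : (\sum_a N a x = d.+1)%N.
  rewrite -[RHS]card_ord -sum1_card.
  rewrite (partition_big (fun i => c (x, i)) xpredT) //=.
  apply: eq_bigr => a _; rewrite /N -sum1_card.
  by apply: eq_bigl => i; rewrite inE.
have N_deg a x : (0 < N a x)%N ->
    (N a x + \sum_y adj x y * N a y <= d.+1)%N.
  case/card_gt0P => i; rewrite inE => /eqP cxi.
  pose B : {set G * 'I_d.+1} :=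
    [set p | adj (s := strong_product G (complete_graph d.+1)) (x, i) p
             && (c p == a)].
  (* S is the closed neighbourhood of (x, i) within its colour class. *)
  pose S : {set G * 'I_d.+1} := [set p | ((p.1 == x) || adj x p.1) && (c p == a)].
  have cardS : #|S| = (N a x + \sum_y adj x y * N a y)%N.
    rewrite -sum1_card.
    rewrite (eq_bigl (fun p => ((p.1 == x) || adj x p.1) && (c (p.1, p.2) == a)));
      last by case=> y j; rewrite inE.
    rewrite -(pair_big_dep (fun y => (y == x) || adj x y)
                (fun y j => c (y, j) == a) (fun _ _ => 1%N)) /=.
    rewrite (bigD1 x) ?eqxx //=; congr (_ + _)%N.
      by rewrite /N -sum1_card; apply: eq_bigl => j; rewrite inE.
    rewrite big_mkcond; apply: eq_bigr => y _.
    case: (eqVneq y x) => [->|_]; rewrite /= ?andbF ?andbT ?adj_irrefl //=.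
    case: (adj x y); rewrite ?mul0n ?mul1n // /N -sum1_card.
    by apply: eq_bigl => j; rewrite inE.
  have SB : S :\ (x, i) \subset B.
    apply/subsetP => -[y j]; rewrite !inE xpair_eqE /= => /andP[yj /andP[xy ->]].
    rewrite andbT /adj /= /strong_adj /= /complete_adj.
    case: (eqVneq y x) xy yj => [->|_] /=; first by rewrite (eq_sym j) => _ ->.
    by move=> ->; case: (eqVneq i j); rewrite ?orbT.
  have := c_imp (x, i); rewrite cxi -ltnS; apply: leq_trans.
  rewrite -cardS (cardsD1 (x, i)) inE /= eqxx cxi eqxx add1n ltnS.
  exact: subset_leq_card SB.
have lnN : 0 < - ln by lra.
have bound := weighted_hoffman R _ k (adjacency_matrix R G) l1 ln d.+1%:R
  (fun a i => (N a (enum_val i))%:R) (adjacency_tr R G).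
suff le_k : l1 - ln <= k%:R * - ln.
  rewrite -(ler_pM2r lnN) (_ : (1 - l1 / ln) * - ln = l1 - ln) //.
  by field; rewrite lt_eqF // -oppr_gt0.
apply: bound => //.
- by move=> i j; rewrite mxE.
- exact: rayleigh_lower (adjacency_tr R G) ln_min.
- move=> a i; rewrite ler0n ler_nat /=.
  by rewrite -[X in (_ <= X)%N](N_sum (enum_val i)) (bigD1 a) //= leq_addr.
- by move=> i; rewrite -natr_sum N_sum.
- move=> a i.
  have -> : \sum_j adjacency_matrix R G i j * (N a (enum_val j))%:R =
      (\sum_y adj (enum_val i) y * N a y)%N%:R :> R.
    rewrite natr_sum (reindex (@enum_val G xpredT)); last first.
      by apply: onW_bij; apply: enum_val_bij.
    by apply: eq_bigr => j _; rewrite mxE natrM.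
  rewrite -natrD -!natrM ler_nat.
  case: (posnP (N a (enum_val i))) => [->|/N_deg le_d]; first by rewrite muln0.
  by rewrite mulnC leq_mul2r le_d orbT.
Qed.

Lemma improper_colourable_strong (G : sgraph) (k d : nat) :
  colourable G k ->
  improper_colourable d (strong_product G (complete_graph d.+1)) k.
Proof.
move=> /existsP[c /forallP c_proper].
apply/existsP; exists [ffun p => c p.1]; apply/forallP => -[x i].
have card_fibre : (#|[set (x, j) | j in [set~ i]]| <= d)%N.
  by rewrite card_imset ?cardsC1 ?card_ord // => j j' [].
apply: leq_trans card_fibre.
apply: subset_leq_card; apply/subsetP => -[y j]; rewrite inE !ffunE /=.
case/andP=> xy /eqP cyx.
have nxy : ~~ adj x y.
  have /forallP/(_ y)/implyP := c_proper x; rewrite cyx eqxx.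
  by move=> H; apply/negP => /H.
move: xy; rewrite /adj /= /strong_adj /= (negPf nxy) /= andbF !orbF.
rewrite /complete_adj => /andP[/eqP <- ij].
by apply/imsetP; exists j; rewrite // !inE eq_sym.
Qed.

Theorem mainTheorem10 (R : realType) (G : sgraph)
    (G_edge : exists u v : G, adj u v)
    (lambda1 lambdan : R)
    (lambda1P : largest_eigenvalue (adjacency_matrix R G) lambda1)
    (lambdanP : smallest_eigenvalue (adjacency_matrix R G) lambdan)
    (hoffman : (chromatic_number G)%:R = 1 - lambda1 / lambdan)
    (d : nat) :
  chromatic_number G =
    improper_chromatic_number d (strong_product G (complete_graph d.+1)).
Proof.
have [u [v uv]] := G_edge.
rewrite /improper_chromatic_number; case: ex_minnP => k k_col k_min.
have k_le : (k <= chromatic_number G)%N.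
  apply: k_min; apply: improper_colourable_strong.
  by rewrite /chromatic_number; case: ex_minnP.
apply/eqP; rewrite eqn_leq k_le andbT -(ler_nat R) hoffman.
exact: improper_hoffman_bound uv lambda1P lambdanP k_col.
Qed.
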